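(* Let $\beta$ be a Parry number with Parry polynomial $n_\beta^*(X)$. If $\xi$ is a beta-conjugate of $\beta$ which is not an algebraic unit, then its multiplicity $\nu_\xi$ as a root of $n_\beta^*(X)$ satisfies $$\nu_\xi\leq\frac{1}{\log 2}\Big(\log\big({\rm H}(n_\beta^* )\big)-\log|N(\beta)|\Big).$$ Moreover, if $|N(\beta)|\geq {\rm H}(n_\beta^* )/3$, then all beta-conjugates of $\beta$ which are not units (if any) are simple roots of $n_\beta^*(X)$.
   Context: For non-integer $\beta>1$, let $d_\beta(1)=0.t_1t_2\ldots$ with $t_1=\lfloor\beta\rfloor$, $t_{j+1}=\lfloor\beta T_\beta^j(1)\rfloor$, $T_\beta(x)=\beta x-\lfloor\beta x\rfloor$; $\beta$ is a Parry number if $(t_i)$ is eventually periodic. Parry polynomial: if $t_i=0$ for $i>m$, $t_m\neq0$: $n_\beta^*(X)=X^m-\sum_{i=1}^mt_iX^{m-i}$; otherwise with minimal preperiod $m\ge0$ and period $p+1$: if $m\ge1$, $n_\beta^*(X)=X^{m+p+1}-\sum_{i=1}^{m+p+1}t_iX^{m+p+1-i}-X^m+\sum_{i=1}^mt_iX^{m-i}$; if $m=0$, $n_\beta^*(X)=X^{p+1}-\sum_{i=1}^pt_iX^{p+1-i}-(1+t_{p+1})$. It is monic in $\mathbb{Z}[X]$ and divisible by the minimal polynomial $P_\beta$ of $\beta$. A beta-conjugate of $\beta$ is a root of $n_\beta^*$ that is not a root of $P_\beta$. ${\rm H}$ denotes the height (maximum modulus of the coefficients), and $N(\beta)$ the algebraic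 norm (product of all Galois conjugates of $\beta$, including $\beta$). *)

(* Defs.v *)
From mathcomp Require Import all_boot all_order all_algebra.
From mathcomp Require Import complex.
From mathcomp Require Import reals exp.

Set Implicit Arguments.
Unset Strict Implicit.
Unset Printing Implicit Defensive.

Import Order.TTheory GRing.Theory Num.Theory.

Local Open Scope ring_scope.

Definition beta_transform (R : realType) (beta x : R) : R :=
  beta * x - (Num.floor (beta * x))%:~R.

(* Digits are indexed from 1: [renyi_digit beta j.+1] is t_(j+1); the value at
   index 0 is meaningless and never used. *)
Definition renyi_digit (R : realType) (beta : R) (i : nat) : int :=
  Num.floor (beta * iter i.-1 (beta_transform beta) 1).

Definition periodic_after (t : nat -> int) (m p : nat) : Prop :=
  forall i, (m < i)%N -> t (i + p.+1)%N = t i.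

Definition parry_number (R : realType) (beta : R) : Prop :=
  [/\ 1 < beta, beta \isn't a Num.int
    & exists m p, periodic_after (renyi_digit beta) m p].

Definition finite_length (t : nat -> int) (m : nat) : Prop :=
  [/\ (0 < m)%N, t m != 0 & forall i, (m < i)%N -> t i = 0].

(* The least preperiod is the same for all periods and the least period the
   same for all preperiods, so the two minimality conditions are compatible. *)
Definition minimal_preperiod_period (t : nat -> int) (m p : nat) : Prop :=
  periodic_after t m p /\
  forall m' p', periodic_after t m' p' -> (m <= m')%N /\ (p <= p')%N.

Definition parry_poly_finite (t : nat -> int) (m : nat) : {poly int} :=
  'X^m - \sum_(1 <= i < m.+1) t i *: 'X^(m - i).

Definition parry_poly_preperiodic (t : nat -> int) (m p : nat) : {poly int} :=
  'X^(m + p + 1) - \sum_(1 <= i < (m + p + 1).+1) t i *: 'X^(m + p + 1 - i)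
  - 'X^m + \sum_(1 <= i < m.+1) t i *: 'X^(m - i).

Definition parry_poly_periodic (t : nat -> int) (p : nat) : {poly int} :=
  'X^(p.+1) - \sum_(1 <= i < p.+1) t i *: 'X^(p.+1 - i) - (1 + t p.+1)%:P.

Variant is_parry_polynomial (R : realType) (beta : R) : {poly int} -> Prop :=
| ParryFinite (m : nat) :
    finite_length (renyi_digit beta) m ->
    is_parry_polynomial beta (parry_poly_finite (renyi_digit beta) m)
| ParryPreperiodic (m p : nat) :
    ~ (exists k, finite_length (renyi_digit beta) k) ->
    minimal_preperiod_period (renyi_digit beta) m p ->
    (1 <= m)%N ->
    is_parry_polynomial beta (parry_poly_preperiodic (renyi_digit beta) m p)
| ParryPeriodic (p : nat) :
    ~ (exists k, finite_length (renyi_digit beta) k) ->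
    minimal_preperiod_period (renyi_digit beta) 0 p ->
    is_parry_polynomial beta (parry_poly_periodic (renyi_digit beta) p).

Definition is_minimal_polynomial (R : realType) (beta : R)
    (P : {poly rat}) : Prop :=
  [/\ P \is monic, root (map_poly ratr P) beta
    & forall q : {poly rat},
        q != 0 -> root (map_poly ratr q) beta -> (size P <= size q)%N].

Definition height (p : {poly int}) : nat := (\max_(i < size p) absz (p`_i)%R)%N.

(* The complex roots of P, listed with multiplicity. *)
Definition galois_conjugates (R : realType) (P : {poly rat}) : seq R[i] :=
  sval (closed_field_poly_normal (map_poly (ratr : rat -> R[i]) P)).

(* For P the minimal polynomial of beta, this is the algebraic norm of beta. *)
Definition alg_norm (R : realType) (P : {poly rat}) : R[i] :=
  \prod_(z <- galois_conjugates R P) z.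

Definition beta_conjugate (R : realType) (n : {poly int}) (P : {poly rat})
    (xi : R[i]) : Prop :=
  root (map_poly (intr : int -> R[i]) n) xi /\
  ~~ root (map_poly (ratr : rat -> R[i]) P) xi.

Definition algebraic_unit (R : realType) (xi : R[i]) : Prop :=
  [/\ xi != 0, integralOver (intr : int -> R[i]) xi
    & integralOver (intr : int -> R[i]) xi^-1].

Definition root_multiplicity (R : realType) (n : {poly int}) (xi : R[i]) : nat :=
  mup xi (map_poly (intr : int -> R[i]) n).

(* Main.v *)
Require Import Defs.
From mathcomp Require Import all_boot all_order all_algebra.
From mathcomp Require Import complex polyorder.
From mathcomp Require Import boolp reals exp.
From mathcomp Require Import zify ring lra.

Set Implicit Arguments.
Unset Strict Implicit.
Unset Printing Implicit Defensive.

Import Order.TTheory GRing.Theory Num.Theory.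

Local Open Scope ring_scope.

(** The Parry polynomial [n] is monic, vanishes at [beta], and has nonzero
    constant term. Let [p] and [q] be the minimal polynomials of [beta] and of
    a beta-conjugate [xi]. By Gauss's lemma both lie in Z[X], and as [q] is
    separable and [xi] is not a root of [p], the product [q ^ nu * p] divides
    [n] in Z[X], where [nu] is the multiplicity of [xi]. Comparing constant
    terms, |q(0)|^nu |N(beta)| divides the nonzero integer n(0), whose absolute
    value is at most the height; and |q(0)| >= 2 because [xi] is not a unit. *)

(** * Elementary estimates and the leading term of the Parry polynomial *)

Lemma powers_unbounded (R : realType) (b M : R) :
  1 < b -> exists k : nat, M < b ^+ k.+1.
Proof.
move=> b1.
have bernoulli k : k%:R * (b - 1) <= b ^+ k.
  elim: k => [|k IH]; first by rewrite mul0r expr0.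
  have bk : 1 <= b ^+ k by rewrite exprn_ege1 // ltW.
  rewrite exprS -natr1; nra.
exists (Num.bound (M / (b - 1))).
apply: lt_le_trans (bernoulli _).
rewrite -ltr_pdivrMr ?subr_gt0 //; apply: (le_lt_trans (ler_norm _)).
by rewrite (lt_trans (unstable.ltr_norm_bound _)) // ltr_nat.
Qed.

Lemma digit_sum_horner (R : comNzRingType) (beta : R) (u : nat -> int) m k :
  (map_poly intr (\sum_(1 <= i < m) u i *: 'X^(k - i))).[beta] =
    \sum_(1 <= i < m) (u i)%:~R * beta ^+ (k - i).
Proof.
rewrite rmorph_sum horner_sum; apply: eq_bigr => i _.
by rewrite /= map_polyZ map_polyXn hornerZ hornerXn.
Qed.

(** As [i] starts at 1, the exponents stay below [k]; for [k = 0] the truncated subtraction gives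
    exponent 0, whence the condition [0 < l]. *)
Lemma size_digit_sum (u : nat -> int) m k l : (0 < l)%N -> (k <= l)%N ->
  (size (\sum_(1 <= i < m) u i *: 'X^(k - i))%R <= l)%N.
Proof.
move=> l0 kl; rewrite big_nat; elim/big_ind: _ => [|p q hp hq|i /andP[i0 _]].
- by rewrite size_poly0.
- by rewrite (leq_trans (size_polyD _ _)) // geq_max hp hq.
by rewrite (leq_trans (size_scale_leq _ _)) // size_polyXn; lia.
Qed.

Lemma coef0_digit_sum (u : nat -> int) k : (0 < k)%N ->
  (\sum_(1 <= i < k.+1) u i *: 'X^(k - i))`_0 = u k.
Proof.
move=> k0; rewrite big_nat_recr //= coefD subnn coefZ coefXn mulr1.
rewrite big_nat coef_sum big1 ?add0r // => i /andP[_ ik].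
by rewrite coefZ coefXn; case: eqP => [|_]; [lia | rewrite mulr0].
Qed.

Lemma monic_XnD (A : nzRingType) (g : {poly A}) k :
  (size g <= k)%N -> 'X^k + g \is monic.
Proof. by move=> gk; rewrite monicE lead_coefDl ?lead_coefXn // size_polyXn. Qed.

Lemma parry_poly_monic (R : realType) (beta : R) n :
  is_parry_polynomial beta n -> n \is monic.
Proof.
case=> [m [m0 _ _]|m p _ _ m0|p _ _].
- by apply: monic_XnD; rewrite size_polyN size_digit_sum.
- rewrite /parry_poly_preperiodic -!addrA; apply: monic_XnD.
  rewrite (leq_trans (size_polyD _ _)) // geq_max size_polyN size_digit_sum /=; try lia.
  rewrite (leq_trans (size_polyD _ _)) // geq_max size_polyN size_polyXn.
  by rewrite size_digit_sum; lia.
rewrite /parry_poly_periodic -!addrA; apply: monic_XnD.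
rewrite (leq_trans (size_polyD _ _)) // geq_max !size_polyN size_digit_sum //=.
by rewrite (leq_trans (size_polyC_leq1 _)).
Qed.

(** * The orbit of 1 under the beta-transformation *)

Section BetaExpansion.

Variables (R : realType) (beta : R).
Let T := beta_transform beta.
Let t := renyi_digit beta.

Lemma beta_transform_itv x : 0 <= T x < 1.
Proof.
by have := floor_itv (beta * x); rewrite /T /beta_transform intrD; lra.
Qed.

Hypothesis beta_gt1 : 1 < beta.

(* [T] multiplies distances by [beta] as long as the digits agree, while the
   orbits stay in [0, 1). *)
Lemma beta_orbit_inj x y :
    (forall k, Num.floor (beta * iter k T x) = Num.floor (beta * iter k T y)) ->
  x = y.
Proof.
move=> eqd.
have expand k : iter k T x - iter k T y = beta ^+ k * (x - y).
  elim: k => [|k IH]; first by rewrite mul1r.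
  by rewrite !iterS {1 3}/T /beta_transform eqd exprS -mulrA -IH; ring.
apply/eqP; rewrite -subr_eq0; apply/negPn/negP => xy0.
(* The exponent is [k.+1] because [x] and [y] are arbitrary: only after one application of [T] are
   both points known to lie in [0, 1). *)
have [k] := powers_unbounded `|x - y|^-1 beta_gt1.
rewrite -div1r ltr_pdivrMr ?normr_gt0 //.
have bk0 : 0 <= beta ^+ k.+1 by rewrite exprn_ge0 // (le_trans ler01) // ltW.
rewrite -{1}(ger0_norm bk0) -normrM -expand !iterS.
by rewrite ltNge ler_norml; have := beta_transform_itv (iter k T x);
   have := beta_transform_itv (iter k T y); lra.
Qed.

(** Unrolling T^(j+1)(1) = beta T^j(1) - t_(j+1). This turns values of digit polynomials at [beta]
    into orbit points. *)
Lemma iter_beta_transform j :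
  iter j T 1 = beta ^+ j - \sum_(1 <= i < j.+1) (t i)%:~R * beta ^+ (j - i).
Proof.
elim: j => [|j IH]; first by rewrite big_geq // subr0.
rewrite iterS big_nat_recr //= subnn expr0 mulr1 opprD addrA {1}/T /beta_transform.
congr (_ - _); rewrite IH mulrBr -exprS mulr_sumr; congr (_ - _).
rewrite !big_nat; apply: eq_bigr => i /andP[_ ij].
by rewrite mulrCA -exprS -subSn.
Qed.

Lemma renyi_digit_ge0 i : (0 < i)%N -> 0 <= t i.
Proof.
case: i => // i _; rewrite floor_ge0 mulr_ge0 //=; first by rewrite (le_trans ler01) // ltW.
case: i => [|i] //=; by case/andP: (beta_transform_itv (iter i T 1)).
Qed.

Lemma periodic_beta_orbit m p : periodic_after t m p ->
  iter (m + p.+1) T 1 = iter m T 1.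
Proof.
move=> per; apply: beta_orbit_inj => k; rewrite -!iterD.
(* Index [i] reads iterate [i.-1], so iterate [k + m] carries the digit of index [(k + m).+1], which
   exceeds [m]. *)
by have := per (k + m).+1; rewrite /t /renyi_digit /= addnA; apply; rewrite ltnS leq_addl.
Qed.

(** From T^m(1) on all digits vanish, as they do for the fixed point 0 of [T], and digits determine
    the point. *)
Lemma finite_beta_orbit m : finite_length t m -> iter m T 1 = 0.
Proof.
case=> m0 _ fin; apply: beta_orbit_inj => k.
have T0 : iter k T 0 = 0.
  by elim: k => //= k ->; rewrite /T /beta_transform mulr0 floor0 subrr.
rewrite T0 mulr0 floor0 -iterD.
by apply: (fin (k + m).+1); rewrite ltnS leq_addl.
Qed.

(** In the three cases the value at [beta] is T^m(1), T^(m+p+1)(1) - T^m(1) and T^(p+1)(1) - 1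
    respectively. *)
Lemma parry_poly_root n : is_parry_polynomial beta n ->
  root (map_poly intr n) beta.
Proof.
case=> [m fin|m p _ [per _] m0|p _ [per _]]; apply/rootP.
- rewrite /parry_poly_finite rmorphB /= map_polyXn hornerD hornerN hornerXn.
  by rewrite digit_sum_horner -iter_beta_transform finite_beta_orbit.
- rewrite /parry_poly_preperiodic rmorphD !rmorphB /= !map_polyXn.
  rewrite !hornerD !hornerN !hornerXn !digit_sum_horner -iter_beta_transform.
  have := periodic_beta_orbit per; rewrite addn1 addnS => ->.
  by rewrite iter_beta_transform; ring.
rewrite /parry_poly_periodic !rmorphB /= map_polyXn map_polyC.
rewrite !hornerD !hornerN !hornerXn hornerC digit_sum_horner.
have := periodic_beta_orbit per; rewrite add0n iter_beta_transform big_nat_recr //=.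
by rewrite subnn expr0 intrD => E; rewrite /t in E *; lra.
Qed.

(* In the preperiodic case [t (m + p + 1) = t m] would make [m - 1] a
   preperiod. *)
Lemma parry_poly_coef0 n : is_parry_polynomial beta n -> n`_0 != 0.
Proof.
case=> [m [m0 tm _]|m p _ [per min] m0|p _ _].
- by rewrite coefB coef0_digit_sum // coefXn ltn_eqF // sub0r oppr_eq0.
- rewrite coefD !coefB !coef0_digit_sum ?coefXn; try lia.
  rewrite !ltn_eqF ?sub0r; try lia.
  rewrite subr0 addrC subr_eq0; apply/negP => /eqP tmp.
  have [] // := min m.-1 p; last by lia.
  move=> i mi; have [mi'|im] := ltnP m i; first exact: per.
  have -> : i = m by lia.
  by rewrite tmp addn1 addnS.
rewrite !coefB coefXn coefC /= sub0r big_nat coef_sum big1 => [|i /andP[_ ip]].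
  (* The constant term is -(1 + t_(p+1)), nonzero because digits are nonnegative. *)
  by rewrite oppr0 sub0r oppr_eq0; have := @renyi_digit_ge0 p.+1 isT; rewrite /t; lia.
by rewrite coefZ coefXn; case: eqP => [|_]; [lia | rewrite mulr0].
Qed.

End BetaExpansion.

(** * Minimal polynomials of algebraic integers *)

Section IntegralMinimalPolynomial.

Variables (F : numFieldType) (z : F).

(** Stated over any [numFieldType], so as to serve both the real [beta] and the complex [xi]. *)
Definition minimal_polynomial (Q : {poly rat}) : Prop :=
  [/\ Q \is monic, root (map_poly ratr Q) z
    & forall q : {poly rat},
        q != 0 -> root (map_poly ratr q) z -> (size Q <= size q)%N].

Lemma minimal_polynomial_exists (q : {poly rat}) :
  q != 0 -> root (map_poly ratr q) z -> exists Q, minimal_polynomial Q.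
Proof.
move=> q0 qz.
pose good k := `[< exists p : {poly rat},
  [/\ p != 0, root (map_poly ratr p) z & size p = k] >].
have ex_good : exists k, good k by exists (size q); apply/asboolP; exists q.
case: (ex_minnP ex_good) => _ /asboolP[p [p0 pz <-]] pmin.
have lp0 : (lead_coef p)^-1 != 0 by rewrite invr_eq0 lead_coef_eq0.
exists ((lead_coef p)^-1 *: p); split.
- by rewrite monicE lead_coefZ mulVf // lead_coef_eq0.
- by rewrite map_polyZ rootZ // fmorph_eq0.
- move=> r r0 rz; rewrite size_scale //; apply: pmin.
  by apply/asboolP; exists r.
Qed.

Lemma minimal_polynomial_dvd (Q q : {poly rat}) :
  minimal_polynomial Q -> root (map_poly ratr q) z -> Q %| q.
Proof.
move=> [Qm Qz Qmin] qz; rewrite /dvdp; apply/negPn/negP => r0.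
suff rz : root (map_poly ratr (q %% Q)) z.
  by have := Qmin _ r0 rz; rewrite leqNgt ltn_modp monic_neq0.
have : root (map_poly ratr (q %/ Q * Q + q %% Q)) z by rewrite -divp_eq.
by rewrite rmorphD rmorphM /root hornerD hornerM (rootP Qz) mulr0 add0r.
Qed.

Lemma map_ratr_intr (q : {poly int}) :
  map_poly (ratr : rat -> F) (map_poly intr q) = map_poly intr q.
Proof.
by rewrite -map_poly_comp; apply: eq_map_poly => c /=; rewrite ratr_int.
Qed.

Lemma map_intr_neq0 (s : {poly int}) : s != 0 -> map_poly (intr : int -> F) s != 0.
Proof. by move=> s0; rewrite map_poly_eq0_id0 ?intr_eq0 ?lead_coef_eq0. Qed.

(** Gauss's lemma makes [Q] a rational multiple of an integer divisor [p] of [n]; as [n] is monic,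
    the leading coefficient of [p] is 1 or -1. *)
Lemma minimal_polynomial_int (Q : {poly rat}) (n : {poly int}) :
    minimal_polynomial Q -> n \is monic -> root (map_poly intr n) z ->
  exists2 q : {poly int}, q \is monic & Q = map_poly intr q.
Proof.
move=> Qmin nm nz; have Qm : Q \is monic by case: Qmin.
have : Q %| map_poly intr n by apply: minimal_polynomial_dvd; rewrite ?map_ratr_intr.
case/dvdpP_rat_int => p [a a0 defQ] [r defn].
have lpr : lead_coef p * lead_coef r = 1 by rewrite -lead_coefM -defn (monicP nm).
have lp2 : lead_coef p * lead_coef p = 1.
  have /eqP : absz (lead_coef p * lead_coef r) = 1%N by rewrite lpr.
  by rewrite abszM muln_eq1 => /andP[/eqP lp1 _]; nia.
have lq : a * (lead_coef p)%:~R = 1.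
  by have := monicP Qm; rewrite defQ lead_coefZ lead_coef_map_inj //; exact: intr_inj.
(* The sign [lead_coef p] is its own inverse, hence equals [a]. *)
exists (lead_coef p *: p); first by rewrite monicE lead_coefZ lp2.
rewrite map_polyZ defQ; congr (_ *: _).
by rewrite -[a]mulr1 -[1](rmorph1 intr) -lp2 rmorphM mulrA lq mul1r.
Qed.

Variable q : {poly int}.
Hypotheses (q_monic : q \is monic) (q_min : minimal_polynomial (map_poly intr q)).

(** Divisibility over the rationals descends to Z[X], with an exact quotient because [q] is
    monic. *)
Lemma minimal_polynomial_int_dvd (s : {poly int}) :
  root (map_poly intr s) z -> exists r, s = r * q.
Proof.
rewrite -map_ratr_intr => /(minimal_polynomial_dvd q_min).
by rewrite dvdp_rat_int => /(Pdiv.IdomainMonic.dvdpP q_monic).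
Qed.

(** At a double root the derivative would also vanish, and in characteristic 0 it is nonzero of
    smaller degree, against minimality. *)
Lemma mup_minimal_polynomial : mup z (map_poly intr q) = 1%N.
Proof.
have [Qm Qz' Qmin] := q_min; have Qz := Qz'; rewrite map_ratr_intr in Qz.
have q0 := map_intr_neq0 (monic_neq0 q_monic).
apply/eqP; rewrite eqn_leq -XsubC_dvd // -root_factor_theorem Qz andbT.
rewrite mup_leq //; apply/negP => /dvdpP[s defq].
pose Q' := (map_poly (intr : int -> rat) q)^`().
have Q'z : root (map_poly ratr Q') z.
  rewrite -deriv_map map_ratr_intr defq expr2 !derivM derivXsubC.
  by rewrite /root !(hornerXsubC, hornerD, hornerM) subrr !(mulr0, mul0r, addr0).
have gt1 : (1 < size (map_poly (intr : int -> rat) q))%N.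
  by rewrite -(size_map_poly (ratr : rat -> F)) (root_size_gt1 _ Qz') // map_ratr_intr.
have sQ' : size Q' = (size (map_poly (intr : int -> rat) q)).-1 by rewrite size_deriv.
have Q'0 : Q' != 0 by rewrite -size_poly_gt0 sQ'; lia.
by have := Qmin _ Q'0 Q'z; rewrite leqNgt lt_size_deriv ?monic_neq0.
Qed.

(** Since [z] is a simple root of [q], dividing by [q] lowers the multiplicity by exactly one;
    induction on the multiplicity follows. *)
Lemma minimal_polynomial_mup_dvd (s : {poly int}) : s != 0 ->
  exists r, s = r * q ^+ mup z (map_poly intr s).
Proof.
move: {2}(mup _ _) (erefl (mup z (map_poly intr s))) => k.
elim: k s => [|k IH] s mus s0; first by exists s; rewrite mus mulr1.
have sz : root (map_poly intr s) z.
  by rewrite root_factor_theorem XsubC_dvd ?map_intr_neq0 // mus.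
have [r defs] := minimal_polynomial_int_dvd sz.
have r0 : r != 0 by apply: contraNneq s0; rewrite defs => ->; rewrite mul0r.
have mur : mup z (map_poly intr r) = k.
  move: mus; rewrite {1}defs rmorphM mupM ?map_intr_neq0 ?(monic_neq0 q_monic) //.
  by rewrite mup_minimal_polynomial addn1 => -[].
have [r' defr] := IH r mur r0.
by exists r'; rewrite mus {1}defs defr mur exprSr mulrA.
Qed.

(** Writing q = aX + q(0) and evaluating at [z] gives a(z) z = -q(0), so the inverse of [z] is -q(0)
    a(z), an integer polynomial in [z]. *)
Lemma minimal_polynomial_unit : absz q`_0 = 1%N ->
  [/\ z != 0, integralOver (intr : int -> F) z
    & integralOver (intr : int -> F) z^-1].
Proof.
move=> q01; have [_ qz _] := q_min; rewrite map_ratr_intr in qz.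
have z_int : integralOver (intr : int -> F) z by exists q.
have [a defq] : exists a, q = a * 'X + (q`_0)%:P.
  exists (drop_poly 1 q); apply/polyP => -[|i]; rewrite !coefE /=.
    by rewrite add0r.
  by rewrite addr0 addn1.
have e : (map_poly intr a).[z] * z = - (q`_0)%:~R.
  apply/eqP; rewrite -subr_eq0 opprK; move: qz; rewrite {1}defq rmorphD rmorphM /=.
  by rewrite map_polyX map_polyC /root hornerD hornerM hornerX hornerC.
have q00 : q`_0 * q`_0 = 1 by nia.
have e1 : (map_poly intr a).[z] * - (q`_0)%:~R * z = 1.
  by rewrite mulrAC e mulrNN -rmorphM q00.
have z0 : z != 0.
  by apply: contra_eq_neq e1 => ->; rewrite mulr0 eq_sym oner_eq0.
split=> //; have -> : z^-1 = (map_poly intr a).[z] * - (q`_0)%:~R.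
  by apply: (mulIf z0); rewrite e1 mulVf.
apply: integral_mul; last by apply: integral_opp; apply: integral_id.
apply: integral_horner => //; apply/integral_poly => i.
by rewrite coef_map; apply: integral_id.
Qed.

End IntegralMinimalPolynomial.

(** * Norm, height and the multiplicity bound *)

Lemma normc_alg_norm (R : realType) (P : {poly rat}) : P \is monic ->
  (ComplexField.Normc.normc (alg_norm R P))%:C%C = `|ratr P`_0 : R[i]|.
Proof.
move=> Pm; rewrite /alg_norm /galois_conjugates.
case: closed_field_poly_normal => s /= defP.
have -> : ratr P`_0 = (map_poly (ratr : rat -> R[i]) P).[0].
  by rewrite horner_coef0 coef_map.
rewrite defP lead_coef_map (monicP Pm) rmorph1 scale1r horner_prod.
(* The embedded [normc] is the norm of [R[i]] by conversion; the factors on the two sides then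
   differ only by a sign inside the norm. *)
rewrite -[LHS]/(`|\prod_(z <- s) z : R[i]|) !normr_prod.
by apply: eq_bigr => z _; rewrite hornerXsubC sub0r normrN.
Qed.

Lemma coef0_le_height (n : {poly int}) : (absz (n`_0)%R <= height n)%N.
Proof.
have [n0|n0] := posnP (size n); last exact: (leq_bigmax (Ordinal n0)).
by rewrite nth_default ?n0.
Qed.

(** The common source of both claims: keeping the bound in natural numbers allows taking logarithms
    for the first and cancelling [N] for the second. *)
Lemma parry_height_bound (R : realType) (beta : R) (n : {poly int})
    (P : {poly rat}) (xi : R[i]) :
    parry_number beta -> is_parry_polynomial beta n ->
    is_minimal_polynomial beta P -> beta_conjugate n P xi ->
    ~ algebraic_unit xi ->
  exists N : nat, [/\ ComplexField.Normc.normc (alg_norm R P) = N%:R, (0 < N)%N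
    & (2 ^ root_multiplicity n xi * N <= height n)%N].
Proof.
move=> [beta1 _ _] hn hP [nxi Pxi] nunit.
have nm := parry_poly_monic hn; have n00 := parry_poly_coef0 beta1 hn.
have nb := parry_poly_root beta1 hn.
have Pmin : minimal_polynomial beta P by [].
have [p pm defP] := minimal_polynomial_int Pmin nm nb.
rewrite defP in Pmin Pxi *; rewrite map_ratr_intr in Pxi.
have [s defn] := minimal_polynomial_int_dvd pm Pmin nb.
have s0 : s != 0 by apply: contraNneq (monic_neq0 nm); rewrite defn => ->; rewrite mul0r.
have [Q Qmin] : exists Q, minimal_polynomial xi Q.
  apply: (@minimal_polynomial_exists _ _ (map_poly intr n)).
    exact: map_intr_neq0 (monic_neq0 nm).
  by rewrite map_ratr_intr.
have [q qm defQ] := minimal_polynomial_int Qmin nm nxi.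
rewrite {}defQ in Qmin.
have [r defs] := minimal_polynomial_mup_dvd qm Qmin s0.
(* The factor [p] does not vanish at [xi], so the whole multiplicity sits in the cofactor [s]. *)
have mu : root_multiplicity n xi = mup xi (map_poly intr s).
  by rewrite /root_multiplicity defn rmorphM mupMl.
rewrite -mu in defs.
have absn : absz n`_0 =
    (absz (r`_0)%R * absz (q`_0)%R ^ root_multiplicity n xi * absz (p`_0)%R)%N.
  by rewrite -!horner_coef0 {1}defn defs !hornerM horner_exp !abszM abszX.
have : (0 < absz (n`_0)%R)%N by rewrite absz_gt0.
rewrite {1}absn !muln_gt0 -andbA => /and3P[r00 q00 p00].
exists (absz p`_0); split=> //.
  apply: (@complexI R); rewrite normc_alg_norm; last by case: Pmin.
  by rewrite coef_map ratr_int -intr_norm -natr_absz rmorph_nat.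
apply: leq_trans (coef0_le_height n); rewrite absn leq_mul //.
apply: leq_trans (leq_pmull _ r00).
(* With a positive exponent it suffices to compare bases: |q(0)| is nonzero, and it is not 1 because
   [xi] is not a unit. *)
have nux : (0 < root_multiplicity n xi)%N.
  by rewrite -XsubC_dvd ?map_intr_neq0 ?monic_neq0 // -root_factor_theorem.
rewrite leq_exp2r // ltn_neqAle; move: q00; rewrite expn_gt0 => /orP[q00|]; last by lia.
rewrite q00 andbT eq_sym; apply/eqP => q01.
exact: nunit (minimal_polynomial_unit qm Qmin q01).
Qed.

Theorem theorem3p7 (R : realType) (beta : R) (n : {poly int}) (P : {poly rat})
    (hbeta : parry_number beta)
    (hn : is_parry_polynomial beta n)
    (hP : is_minimal_polynomial beta P) :
  (forall xi : R[i], beta_conjugate n P xi -> ~ algebraic_unit xi ->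
     (root_multiplicity n xi)%:R
       <= (ln 2)^-1 * (ln ((height n)%:R : R) - ln (ComplexField.Normc.normc (alg_norm R P)))) /\
  ((height n)%:R / 3 <= ComplexField.Normc.normc (alg_norm R P) ->
     forall xi : R[i], beta_conjugate n P xi -> ~ algebraic_unit xi ->
       root_multiplicity n xi = 1%N).
Proof.
split=> [xi hxi nu|hN xi hxi nu].
  have [N [-> N0 hNH]] := parry_height_bound hbeta hn hP hxi nu.
  have N0' : 0 < N%:R :> R by rewrite ltr0n.
  have ln2 : 0 < ln 2 :> R by rewrite ln_gt0 // ltr1n.
  (* After clearing [ln 2], the claim reads ln(2^nu N) <= ln H, with nu the multiplicity and H the
     height. *)
  rewrite ler_pdivlMl // lerBrDr mulr_natr -lnXn // -lnM ?posrE ?exprn_gt0 //.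
  rewrite ler_ln ?posrE ?mulr_gt0 ?exprn_gt0 // -?natrX -?natrM ?ler_nat //.
  by rewrite ltr0n (leq_trans _ hNH) // muln_gt0 expn_gt0.
have [N [eN N0 hNH]] := parry_height_bound hbeta hn hP hxi nu.
move: hN; rewrite eN ler_pdivrMr // -natrM ler_nat => hN.
(* Cancelling [N] in 2^nu N <= H <= 3N leaves 2^nu <= 3 < 4, so nu is at most 1. *)
have : (2 ^ root_multiplicity n xi <= 3)%N.
  by rewrite -(leq_pmul2r N0) (leq_trans hNH) // mulnC.
have : (0 < root_multiplicity n xi)%N.
  case: hxi => nxi _; rewrite -XsubC_dvd -?root_factor_theorem // map_intr_neq0 //.
  exact: monic_neq0 (parry_poly_monic hn).
case: (root_multiplicity n xi) => [|[|k]] // _; rewrite !expnS.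
by have := expn_gt0 2 k; lia.
Qed.
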